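(* Let $(P,\omega)$ be a labeled poset, let $\mathrm I$ denote the identity matrix indexed by $\mathcal I(P)$, and set $\widetilde A(P,\omega)=\mathrm I+A(P,\omega)$. Then $$E(P,\omega;\lambda)=\bigl(\mathrm I-\lambda\widetilde A(P,\omega)\bigr)^{-1}$$ and $$E(P,\omega;\lambda)=\frac1{1-\lambda}\Bigl(\mathrm I-\frac{\lambda}{1-\lambda}A(P,\omega)\Bigr)^{-1}.$$
   Context: All posets are finite and $\mathbb N^+=\{1,2,\dots\}$. An ideal of a poset $P$ is a down-closed subset; $\mathcal I(P)$ is the set of all ideals, including $\emptyset$ and $P$. A labeled poset $(P,\omega)$ is a finite poset $P$ with an injective map $\omega:P\to\mathbb N^+$. A subset $S\subseteq P$ is $\omega$-natural if $\omega|_S$ is order-preserving ($\emptyset$ is $\omega$-natural). The matrix $A(P,\omega)$ has rows and columns indexed by $\mathcal I(P)$; its $(I,J)$ entry is $1$ if $I\subsetneq J$ and $J\setminus I$ is $\omega$-natural, and $0$ otherwise (it is nilpotent). Define $$\Phi(P,\omega)=\ln(1+A(P,\omega))=\sum_{n\ge1}\frac{(-1)^{n-1}}{n}A(P,\omega)^n,\qquad \Theta(P,\omega;t)=e^{t\Phi(P,\omega)}=\sum_{n\ge0}\frac{\Phi(P,\omega)^n}{n!}t^n,$$ and, as a matrix of formal power series in the variable $\lambda$, $$E(P,\omega;\lambda)=\sum_{n=0}^\infty\Theta(P,\omega;n)\lambda^n .$$ *)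

(* Defs.v *)
From HB Require Import structures.
From mathcomp Require Import all_boot all_order all_algebra.
From mathcomp Require Import boolp classical_sets fsbigop.

Set Implicit Arguments.
Unset Strict Implicit.
Unset Printing Implicit Defensive.

Import Order.TTheory GRing.Theory Num.Theory.
Local Open Scope ring_scope.

(* [fps R] is R[[λ]], with [fpsX] for λ and [fpsC] for the constants. *)
Record fps (R : Type) := Fps { fps_coef : nat -> R }.

HB.instance Definition _ (R : Type) := gen_eqMixin (fps R).
HB.instance Definition _ (R : Type) := gen_choiceMixin (fps R).

Lemma fpsP (R : Type) (f g : fps R) :
  (forall n, fps_coef f n = fps_coef g n) -> f = g.
Proof. by case: f g => [f] [g] /= /funext ->. Qed.

Section FpsZmodule.
Variable V : zmodType.

Definition fps_zero : fps V := Fps (fun=> 0).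
Definition fps_opp (f : fps V) : fps V := Fps (fun n => - fps_coef f n).
Definition fps_add (f g : fps V) : fps V :=
  Fps (fun n => fps_coef f n + fps_coef g n).

Fact fps_addA : associative fps_add.
Proof. by move=> f g h; apply: fpsP => n /=; rewrite addrA. Qed.
Fact fps_addC : commutative fps_add.
Proof. by move=> f g; apply: fpsP => n /=; rewrite addrC. Qed.
Fact fps_add0 : left_id fps_zero fps_add.
Proof. by move=> f; apply: fpsP => n /=; rewrite add0r. Qed.
Fact fps_addN : left_inverse fps_zero fps_opp fps_add.
Proof. by move=> f; apply: fpsP => n /=; rewrite addNr. Qed.

HB.instance Definition _ :=
  GRing.isZmodule.Build (fps V) fps_addA fps_addC fps_add0 fps_addN.

End FpsZmodule.

Section FpsRing.
Variable R : comNzRingType.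

Definition fpsC (c : R) : fps R := Fps (fun n => if n == 0%N then c else 0).
Definition fpsX : fps R := Fps (fun n => (n == 1%N)%:R).

Definition fps_mul (f g : fps R) : fps R :=
  Fps (fun n => \sum_(i < n.+1) fps_coef f i * fps_coef g (n - i)%N).

Fact fps_mulC : commutative fps_mul.
Proof.
move=> f g; apply: fpsP => n /=; rewrite (reindex_inj rev_ord_inj) /=.
by apply: eq_bigr => i _; rewrite subSS subKn ?leq_ord// mulrC.
Qed.

Fact fps_mulA : associative fps_mul.
Proof.
move=> p q r; apply: fpsP => i; rewrite (fps_mulC (fps_mul p q)) /=.
pose a := fps_coef p; pose b := fps_coef q; pose c := fps_coef r.
pose coef3 j k := a j * (b (i - j - k)%N * c k).
transitivity (\sum_(j < i.+1) \sum_(k < i.+1 | (k <= i - j)%N) coef3 j k).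
  apply: eq_bigr => j _.
  have -> : \sum_(k < (i - j).+1) fps_coef q k * fps_coef r (i - j - k) =
            fps_coef (fps_mul r q) (i - j) by rewrite fps_mulC.
  rewrite big_distrr /= (big_ord_narrow_leq (leq_subr _ _)) /=.
  by apply: eq_bigr => k _; rewrite /coef3 [c _ * _]mulrC.
rewrite (exchange_big_dep predT) //=; apply: eq_bigr => k _.
transitivity (\sum_(j < i.+1 | (j <= i - k)%N) coef3 j k).
  apply: eq_bigl => j; rewrite -ltnS -(ltnS j) -!subSn ?leq_ord //.
  by rewrite -subn_gt0 -(subn_gt0 j) -!subnDA addnC.
rewrite (big_ord_narrow_leq (leq_subr _ _)) big_distrr /=.
by apply: eq_bigr => j _; rewrite /coef3 -!subnDA addnC mulrA mulrC.
Qed.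

Fact fps_mul1 : left_id (fpsC 1) fps_mul.
Proof.
move=> f; apply: fpsP => n /=; rewrite big_ord_recl /= mul1r subn0.
by rewrite big1 ?addr0 // => i _; rewrite mul0r.
Qed.

Fact fps_mulDl : left_distributive fps_mul +%R.
Proof.
move=> f g h; apply: fpsP => n /=; rewrite -big_split /=.
by apply: eq_bigr => i _; rewrite mulrDl.
Qed.

Fact fps_1neq0 : fpsC 1 != 0.
Proof.
apply/eqP => /(congr1 (fun f => fps_coef f 0)) /= /eqP.
by rewrite oner_eq0.
Qed.

HB.instance Definition _ := GRing.Zmodule_isComNzRing.Build (fps R)
  fps_mulA fps_mulC fps_mul1 fps_mulDl fps_1neq0.

Definition fps_unit : pred (fps R) := fun f => `[< exists g, g * f = 1 >].
Definition fps_inv (f : fps R) : fps R :=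
  if pselect (exists g, g * f = 1) is left e then sval (cid e) else f.

Fact fps_mulV : {in fps_unit, left_inverse 1 fps_inv *%R}.
Proof.
move=> f /asboolP f1; rewrite /fps_inv.
by case: pselect => // e; case: cid.
Qed.
Fact fps_unitP (f g : fps R) : g * f = 1 -> fps_unit f.
Proof. by move=> gf; apply/asboolP; exists g. Qed.
Fact fps_inv_out : {in [predC fps_unit], fps_inv =1 id}.
Proof. by move=> f /asboolP f1; rewrite /fps_inv; case: pselect. Qed.

HB.instance Definition _ := GRing.ComNzRing_hasMulInverse.Build (fps R)
  fps_mulV fps_unitP fps_inv_out.

Lemma unit_1BfpsX : 1 - fpsX \is a GRing.unit.
Proof.
apply: (@fps_unitP _ (Fps (fun=> 1))); apply: fpsP => n.
rewrite mulrC /= big_ord_recl /= oppr0 addr0 mul1r.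
case: n => [|n]; first by rewrite big_ord0 addr0.
rewrite big_ord_recl /= sub0r mulr1 big1 ?addr0 ?subrr // => i _.
by rewrite mul0r.
Qed.

End FpsRing.
Arguments fpsX {R}.

Section LabeledPoset.
Context {d : Order.disp_t} {P : finPOrderType d}.

Definition is_ideal (I : {set P}) : bool :=
  [forall x in I, forall y, (y <= x)%O ==> (y \in I)].

Definition is_natural (omega : P -> nat) (S : {set P}) : bool :=
  [forall x in S, forall y in S, (x <= y)%O ==> (omega x <= omega y)%N].

End LabeledPoset.

Definition ideals {d : Order.disp_t} (P : finPOrderType d) : {set {set P}} :=
  [set I | is_ideal I].

(* The rows and columns indexed by the ideals are indexed by 'I_#|ideals P|,
   through the bijection [ideal_of] onto [ideals P]. *)
Definition ideal_of {d : Order.disp_t} {P : finPOrderType d}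
  (i : 'I_#|ideals P|) : {set P} := enum_val i.

Section Matrices.
Variable R : numFieldType.
Context {d : Order.disp_t} {P : finPOrderType d}.
Variable omega : P -> nat.

Definition A_mx : 'M[R]_#|ideals P| :=
  \matrix_(i, j) ((ideal_of i \proper ideal_of j)
                  && is_natural omega (ideal_of j :\: ideal_of i))%:R.

Definition tildeA_mx : 'M[R]_#|ideals P| := 1%:M + A_mx.

(* [\sum_(n \in D) F n] is the sum of the nonzero terms F n, n in D, when there
   are finitely many of them (and 0 otherwise). Since A_mx is nilpotent, so is
   Phi_mx, and both series below have only finitely many nonzero terms. *)
Definition Phi_mx : 'M[R]_#|ideals P| :=
  \sum_(n \in [set n : nat | (1 <= n)%N]%classic)
    ((-1) ^+ n.-1 / n%:R) *: A_mx ^+ n.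

Definition Theta_mx (t : R) : 'M[R]_#|ideals P| :=
  \sum_(n \in [set: nat]%classic) (t ^+ n / n`!%:R) *: Phi_mx ^+ n.

Definition E_mx : 'M[fps R]_#|ideals P| :=
  \matrix_(i, j) Fps (fun n => Theta_mx n%:R i j).

End Matrices.

(* Main.v *)
(* The core is Θ(n) = (1 + A)^n for natural n; then E is the geometric series of
   1 + A, and the second formula is the first one with 1 - λ factored out.
   As A is nilpotent, the core identity only has to hold between polynomials
   modulo a power of X. There e^(n ln(1+X)) and (1+X)^n agree, having the same
   value at 0 and both solving (1 + X) f' = n f; this uniqueness argument avoids
   the functional equation of the exponential. *)
Require Import Defs.
From mathcomp Require Import all_boot all_order all_algebra.
From mathcomp Require Import boolp classical_sets fsbigop.
From mathcomp Require Import ring.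
Import Order.TTheory GRing.Theory Num.Theory.
Local Open Scope ring_scope.

Lemma fsbig_geq_nat (V : zmodType) (a b : nat) (F : nat -> V) :
  (forall n, (b <= n)%N -> F n = 0) ->
  \sum_(n \in [set n | (a <= n)%N]%classic) F n = \sum_(a <= n < b) F n.
Proof.
move=> F0; rewrite (fsbigE (index_iota a b)) ?iota_uniq //.
- rewrite [LHS]big_mkcond big_seq [RHS]big_seq; apply: eq_bigr => n.
  by rewrite mem_index_iota => /andP[an _]; rewrite mem_set.
- by move=> n /=; rewrite mem_index_iota => /andP[].
- by move=> n /= an; rewrite mem_index_iota an /= -leqNgt => /F0.
Qed.

Section LogExp.
Variable R : numFieldType.
Implicit Types p q : {poly R}.

(* ln (1 + X), truncated after X^N. *)
Definition log_poly (N : nat) : {poly R} :=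
  \sum_(i < N) ((-1) ^+ i / i.+1%:R) *: 'X^(i.+1).

(** Powers of p stop below N here, so [exp_poly N.+1] is what reaches the order of [log_poly N]. *)
Definition exp_poly (N : nat) (t : R) p : {poly R} :=
  \sum_(i < N) (t ^+ i / i`!%:R) *: p ^+ i.

Lemma log_poly_factor N : exists q, log_poly N = 'X * q.
Proof.
exists (\sum_(i < N) ((-1) ^+ i / i.+1%:R) *: 'X^i).
by rewrite mulr_sumr; apply: eq_bigr => i _; rewrite -scalerAr -exprS.
Qed.

(** Differentiating termwise leaves a finite geometric sum in - X, which the factor 1 + X
    telescopes. *)
Lemma deriv_log_poly N : (1 + 'X) * (log_poly N)^`() = 1 - (- 'X) ^+ N.
Proof.
rewrite -[in RHS](expr1n _ N) subrXX opprK; congr (_ * _).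
rewrite raddf_sum /=; apply: eq_bigr => i _.
rewrite derivZ derivXn /= expr1n mul1r -scaler_nat scalerA divfK ?pnatr_eq0 //.
by rewrite [in RHS]exprNn -mul_polyC rmorphXn rmorphN1.
Qed.

Lemma deriv_exp_poly N t p :
  (exp_poly N.+1 t p)^`() = t *: (p^`() * exp_poly N t p).
Proof.
rewrite /exp_poly big_ord_recl linearD /= expr0 derivZ derivC scaler0 add0r.
rewrite raddf_sum /= mulr_sumr scaler_sumr; apply: eq_bigr => i _.
rewrite derivZ deriv_exp /= -scalerAr scalerA -scaler_nat scalerA.
congr (_ *: _); rewrite /bump /= add1n exprS factS natrM.
rewrite invfM -!mulrA; congr (_ * (_ * _)).
by rewrite mulrCA mulVf ?pnatr_eq0 // mulr1.
Qed.

(* Comparing coefficients of X^k for k < N gives (k+1) p_(k+1) = (t-k) p_k. *)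
Lemma truncated_ode_uniq N t p q : p`_0 = 0 ->
    (1 + 'X) * p^`() - t *: p = 'X^N * q ->
  exists r, p = 'X^(N.+1) * r.
Proof.
move=> p0 ode; exists (drop_poly N.+1 p).
rewrite -[LHS](poly_take_drop N.+1) mulrC -[RHS]add0r; congr (_ + _).
suff p_eq0 k : (k <= N)%N -> p`_k = 0.
  apply/polyP => k; rewrite coef_take_poly coef0.
  by case: ltnP => // /p_eq0.
elim: k => [|k IHk] // kN; have /(congr1 (fun f : {poly R} => f`_k)) := ode.
rewrite coefXnM kN coefB coefZ mulrDl mul1r coefD coefXM !coef_deriv.
have pk : p`_k = 0 by apply: IHk; exact: ltnW.
have -> : (if k == 0%N then 0 else p`_k.-1.+1 *+ k.-1.+1) = 0.
  by case: k pk {kN IHk} => // k /= ->; rewrite mul0rn.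
by rewrite pk mulr0 subr0 addr0 => /eqP; rewrite mulrn_eq0 => /eqP.
Qed.

Lemma exp_log_poly N m :
  exists r, exp_poly N.+1 m%:R (log_poly N) = (1 + 'X) ^+ m + 'X^(N.+1) * r.
Proof.
set t : R := m%:R; set L := log_poly N; set F := exp_poly N.+1 t L.
suff [r Fr] : exists r, F - (1 + 'X) ^+ m = 'X^(N.+1) * r.
  by exists r; rewrite -Fr addrC subrK.
have [L1 L1E] : exists q, L = 'X * q by exact: log_poly_factor.
have FE : exp_poly N t L = F - (t ^+ N / N`!%:R) *: L ^+ N.
  by rewrite /F /exp_poly big_ord_recr /= addrK.
pose c : R := t ^+ N / N`!%:R.
(* The witness collects two truncation errors: the term (- X)^N of [deriv_log_poly] times
   [exp_poly N t L], and the top term c L^N lost when differentiating the exponential, where L^N =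
   X^N L1^N. *)
apply: (@truncated_ode_uniq N t _
  (t *: (- (-1) ^+ N * (F - c *: L ^+ N) - c *: L1 ^+ N))).
  rewrite coefB -!horner_coef0 !hornerE expr1n /F /exp_poly horner_sum.
  rewrite big_ord_recl big1 => [|i _].
    by rewrite !expr0 fact0 divr1 scale1r hornerC addr0 subrr.
  by rewrite L1E !hornerE lift0 expr0n mulr0.
have odeB : (1 + 'X) * ((1 + 'X) ^+ m)^`() = t *: (1 + 'X : {poly R}) ^+ m.
  rewrite deriv_exp derivD derivC derivX add0r mul1r /t scaler_nat.
  by case: m {t F FE c} => [|m]; rewrite ?mulr0n ?mulr0 // mulrnAr -exprS.
rewrite derivB mulrBr odeB deriv_exp_poly -scalerAr mulrA deriv_log_poly -/L FE.
have -> : L ^+ N = 'X^N * L1 ^+ N by rewrite L1E exprMn.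
rewrite [(- 'X) ^+ N]exprNn -!mul_polyC.
(* With the powers abstracted to atoms, only a commutative ring identity is left. *)
move: {FE odeB} F c%:P t%:P ((-1) ^+ N) ('X^N) (L1 ^+ N) ((1 + 'X) ^+ m).
by move=> *; ring.
Qed.

End LogExp.

(** Evaluating [exp_log_poly] at A kills the remainder, a multiple of X^(N+1). *)
Lemma nilpotent_exp_log (R : numFieldType) (n N : nat) (A : 'M[R]_n) :
    A ^+ N.+1 = 0 ->
  let Phi :=
    \sum_(k \in [set k | (1 <= k)%N]%classic) ((-1) ^+ k.-1 / k%:R) *: A ^+ k in
  forall m, \sum_(k \in [set: nat]%classic) (m%:R ^+ k / k`!%:R) *: Phi ^+ k
            = (1 + A) ^+ m.
Proof.
(* In size 0 all matrices are equal; positive size gives access to [horner_mx]. *)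
case: n A => [|n] A A0 Phi m; first by apply/matrixP => - [].
have A_eq0 k : (N < k)%N -> A ^+ k = 0.
  by move=> /subnK <-; rewrite exprD A0 mulr0.
have PhiE : Phi = horner_mx A (log_poly R N).
  rewrite /Phi (@fsbig_geq_nat _ _ N.+1) => [|k Nk].
    rewrite big_add1 big_mkord raddf_sum; apply: eq_bigr => i _ /=.
    by rewrite linearZ rmorphXn /= horner_mx_X.
  by rewrite A_eq0 ?scaler0.
(* X divides [log_poly N], so Phi^k has the factor A^k. *)
have Phi0 k : (N < k)%N -> Phi ^+ k = 0.
  have [q qE] := log_poly_factor R N.
  move=> Nk; rewrite PhiE qE -rmorphXn exprMn rmorphM rmorphXn /= horner_mx_X.
  by rewrite A_eq0 // mul0r.
have -> : [set: nat]%classic = [set k | (0 <= k)%N]%classic.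
  by apply/seteqP; split.
rewrite (@fsbig_geq_nat _ _ N.+1) => [|k Nk]; last by rewrite Phi0 ?scaler0.
rewrite big_mkord; have [r rE] := exp_log_poly R N m.
transitivity (horner_mx A (exp_poly R N.+1 m%:R (log_poly R N))).
  rewrite raddf_sum; apply: eq_bigr => i _ /=.
  by rewrite linearZ rmorphXn /= PhiE.
rewrite rE rmorphD rmorphM !rmorphXn /= rmorphD rmorph1 /= horner_mx_X.
by rewrite A0 mul0r addr0.
Qed.

(** A nonzero (i, j) entry of A^k requires a chain of k proper inclusions from ideal i to ideal j,
    hence at least k more elements in ideal j. *)
Lemma A_mx_nilpotent (R : numFieldType) (d : Order.disp_t)
    (P : finPOrderType d) (omega : P -> nat) : A_mx R omega ^+ #|P|.+1 = 0.
Proof.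
have card_lt k i j : (#|ideal_of j| < #|ideal_of i| + k)%N ->
    (A_mx R omega ^+ k) i j = 0.
  elim: k i j => [|k IHk] i j.
    rewrite addn0 expr0 mxE; case: eqP => // ->.
    by rewrite ltnn.
  move=> ij; rewrite exprS mxE big1 // => l _; rewrite mxE.
  case: (boolP (ideal_of i \proper ideal_of l)) => [il|_]; last by rewrite mul0r.
  rewrite IHk ?mulr0 //; apply: leq_trans ij _.
  by rewrite addnS -addSn leq_add2r; exact: proper_card.
apply/matrixP => i j; rewrite mxE card_lt // addnS ltnS.
by rewrite (leq_trans (max_card _)) ?leq_addl.
Qed.

Lemma geometric_fps_mx (R : comNzRingType) (n : nat) (B : 'M[R]_n) :
  (\matrix_(i, j) Fps (fun k => (B ^+ k) i j)) *m
    (1%:M - fpsX *: map_mx (@fpsC R) B) = 1%:M.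
Proof.
set S := \matrix_(i, j) _.
(* The geometric series is its constant term plus λ times itself times B; this is checked
   coefficient by coefficient. *)
suff SE : S = 1%:M + fpsX *: (S *m map_mx (@fpsC R) B).
  by rewrite mulmxBr mulmx1 -scalemxAr {1}SE addrK.
have coefCM (c : R) (f : fps R) k :
    fps_coef (fpsC c * f) k = c * fps_coef f k.
  rewrite /= big_ord_recl /= subn0 big1 ?addr0 // => l _.
  by rewrite mul0r.
have coefXM (f : fps R) k :
    fps_coef (fpsX * f) k = if k is k'.+1 then fps_coef f k' else 0.
  rewrite /= big_ord_recl mul0r add0r; case: k => [|k]; first by rewrite big_ord0.
  rewrite big_ord_recl /= mul1r subSS subn0 big1 ?addr0 // => l _.
  by rewrite mul0r.
have coefD (f g : fps R) k : fps_coef (f + g) k = fps_coef f k + fps_coef g k.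
  by [].
have coef_sum (I : finType) (F : I -> fps R) k :
    fps_coef (\sum_i F i) k = \sum_i fps_coef (F i) k.
  by elim/big_rec2: _ => // i x f _ <-.
apply/matrixP => i j; rewrite !mxE; apply: fpsP => k.
rewrite coefD coefXM [LHS]/=; case: k => [|k].
  by rewrite expr0 mxE addr0; case: (i == j).
have -> : fps_coef (i == j)%:R k.+1 = 0 :> R by case: (i == j).
rewrite add0r coef_sum exprSr mxE; apply: eq_bigr => l _.
by rewrite !mxE mulrC [in RHS]mulrC coefCM.
Qed.

(* [invmx M] is the inverse of M only when M is invertible, whence the two
   [unitmx] clauses; 1 - λ is a unit of R[[λ]] by [unit_1BfpsX]. *)
Theorem theorem2p14 (R : numFieldType) (d : Order.disp_t)
    (P : finPOrderType d) (omega : P -> nat)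
    (omega_inj : injective omega) (omega_gt0 : forall x : P, (0 < omega x)%N) :
  let A := map_mx (@fpsC R) (A_mx R omega) in
  let tildeA := map_mx (@fpsC R) (tildeA_mx R omega) in
  let M1 := 1%:M - fpsX *: tildeA in
  let M2 := 1%:M - (fpsX / (1 - fpsX)) *: A in
  [/\ M1 \in unitmx, E_mx R omega = invmx M1,
      M2 \in unitmx & E_mx R omega = (1 - fpsX)^-1 *: invmx M2].
Proof.
move=> A tildeA M1 M2.
have E_M1 : E_mx R omega *m M1 = 1%:M.
  rewrite -[RHS](geometric_fps_mx _ _ (tildeA_mx R omega)); congr (_ *m _).
  apply/matrixP => i j; rewrite !mxE; apply: fpsP => k /=.
  by rewrite /Theta_mx (nilpotent_exp_log _ _ _ _ (A_mx_nilpotent R d P omega)).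
(* For square matrices over a commutative ring, a one-sided inverse is two-sided. *)
have [_ M1_unit] := mulmx1_unit E_M1.
have EE : E_mx R omega = invmx M1 by rewrite -[LHS](mulmxK M1_unit) E_M1 mul1mx.
have X1 := unit_1BfpsX R.
have tildeAE : tildeA = 1%:M + A.
  apply/matrixP => i j; rewrite !mxE; apply: fpsP => k /=.
  by case: (i == j); case: k => [|k] /=; rewrite ?addr0.
have XE : (1 - fpsX) * (fpsX / (1 - fpsX)) = fpsX :> fps R by rewrite mulrC divrK.
(* 1 - λ(1 + A) = (1 - λ) - λA, and 1 - λ can be factored out since it is a unit. *)
have M12 : M1 = (1 - fpsX) *: M2.
  rewrite /M1 /M2 tildeAE scalerBr scalerA XE scalerBl scale1r scalerDr.
  by rewrite opprD addrA.
clearbody M1 M2.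
have M2_unit : M2 \in unitmx by rewrite -(unitmxZ _ X1) -M12.
by split=> //; rewrite EE M12 invmxZ // -M12.
Qed.
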